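(* Assume $\langle\mathfrak K^{\heartsuit},\mathfrak K\rangle$ is a normed category with the almost amalgamation property and with a Fraïssé sequence $\vec u$. Then for every sequence $\vec x$ in $\mathfrak K^{\heartsuit}$ there exists an approximate arrow $\vec f\colon\vec x\to\vec u$ such that $\mu(\vec f)=0$.
   Context: A category $\mathfrak K$ is metric-enriched if each hom-set $\mathfrak K(a,b)$ carries a metric $\rho$ (the value $+\infty$ is allowed) such that $\rho(f_0\circ g,f_1\circ g)\leqslant\rho(f_0,f_1)$ and $\rho(h\circ f_0,h\circ f_1)\leqslant\rho(f_0,f_1)$ whenever the compositions make sense. A normed category is a pair $\langle\mathfrak K^{\heartsuit},\mathfrak K\rangle$ where $\mathfrak K$ is a metric-enriched category and $\mathfrak K^{\heartsuit}$ is a subcategory of $\mathfrak K$ with the same objects. For $f\in\mathfrak K$ put $\mu(f)=\inf\{\rho(j\circ f,i)\colon i,j\in\mathfrak K^{\heartsuit},\ \operatorname{dom}(j)=\operatorname{cod}(f),\ \operatorname{dom}(i)=\operatorname{dom}(f),\ \operatorname{cod}(i)=\operatorname{cod}(j)\}$, with $\inf\emptyset=+\infty$. The normed category has the almost amalgamation property if for all $\mathfrak K^{\heartsuit}$-arrows $f\colon c\to a$, $g\colon c\to b$ and every $\varepsilon>0$ there are $\mathfrak K^{\heartsuit}$-arrows $f'\colon a\to w$, $g'\colon b\to w$ with $\rho(f'\circ f,g'\circ g)<\varepsilon$. A sequence $\vec x$ in $\mathfrak K^{\heartsuit}$ is a covariant functor from $\omega$ into $\mathfrak K^{\heartsuit}$,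 with objects $x_n$ and arrows $x_n^m\colon x_n\to x_m$ ($n\leqslant m$). An approximate arrow $\vec f\colon\vec x\to\vec y$ between sequences in $\mathfrak K^{\heartsuit}$ consists of an increasing map $\varphi\colon\omega\to\omega$ and $\mathfrak K$-arrows $f_n\colon x_n\to y_{\varphi(n)}$ such that for every $\varepsilon>0$ there is $n_0$ with $\rho(f_m\circ x_n^m,\ y_{\varphi(n)}^{\varphi(m)}\circ f_n)<\varepsilon$ whenever $n_0\leqslant n<m$. For an approximate arrow, $\mu(\vec f)=\lim_{n\to\infty}\mu(f_n)$. A sequence $\vec u$ in $\mathfrak K^{\heartsuit}$ is Fraïssé in $\langle\mathfrak K^{\heartsuit},\mathfrak K\rangle$ if: (U) for every object $x$ and every $\varepsilon>0$ there are $n\in\omega$ and a $\mathfrak K$-arrow $f\colon x\to u_n$ with $\mu(f)<\varepsilon$; (A) given $\varepsilon>0$ and a $\mathfrak K^{\heartsuit}$-arrow $f\colon u_n\to y$, there are $m>n$ and a $\mathfrak K$-arrow $g\colon y\to u_m$ with $\mu(g)<\varepsilon$ and $\rho(u_n^m,g\circ f)<\varepsilon$. *)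

(* Defs.v *)
From HB Require Import structures.
From mathcomp Require Import all_boot all_order all_algebra.
From mathcomp Require Import all_classical all_reals all_analysis.

Set Implicit Arguments.
Unset Strict Implicit.
Unset Printing Implicit Defensive.
Import Order.TTheory GRing.Theory Num.Theory.
Import numFieldNormedType.Exports.
Local Open Scope classical_set_scope.
Local Open Scope ring_scope.
Local Open Scope ereal_scope.

(* [ccomp g f] is "g after f". *)
Record category := Category {
  obj :> Type;
  homset : obj -> obj -> Type;
  idm : forall a, homset a a;
  ccomp : forall a b c, homset b c -> homset a b -> homset a c;
  ccomp_idl : forall a b (f : homset a b), ccomp (idm b) f = f;
  ccomp_idr : forall a b (f : homset a b), ccomp f (idm a) = f;
  ccomp_assoc : forall a b c d
      (h : homset c d) (g : homset b c) (f : homset a b),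
    ccomp h (ccomp g f) = ccomp (ccomp h g) f }.

Declare Scope cat_scope.
Delimit Scope cat_scope with cat.
Notation "g \oc f" := (ccomp g f)
  (at level 40, left associativity) : cat_scope.
Local Open Scope cat_scope.

Record metricCategory (R : realType) := MetricCategory {
  mcat :> category;
  rho : forall a b : mcat, homset a b -> homset a b -> \bar R;
  rho_ge0 : forall (a b : mcat) (f g : homset a b), 0 <= rho f g;
  rho_eq0 : forall (a b : mcat) (f g : homset a b), rho f g = 0 <-> f = g;
  rho_sym : forall (a b : mcat) (f g : homset a b), rho f g = rho g f;
  rho_triangle : forall (a b : mcat) (f g h : homset a b),
    rho f h <= rho f g + rho g h;
  rho_comp_right : forall (a b c : mcat) (f0 f1 : homset b c) (g : homset a b),
    rho (f0 \oc g) (f1 \oc g) <= rho f0 f1;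
  rho_comp_left : forall (a b c : mcat) (h : homset b c) (f0 f1 : homset a b),
    rho (h \oc f0) (h \oc f1) <= rho f0 f1 }.

(* [heart f] says that [f] belongs to the wide subcategory. *)
Record normedCategory (R : realType) := NormedCategory {
  ncat :> metricCategory R;
  heart : forall a b : ncat, set (homset a b);
  heart_id : forall a : ncat, heart (idm a);
  heart_comp : forall (a b c : ncat) (g : homset b c) (f : homset a b),
    heart g -> heart f -> heart (g \oc f) }.

Definition mu (R : realType) (K : normedCategory R) (a b : K) (f : homset a b) :
    \bar R :=
  ereal_inf [set r | exists (w : K) (j : homset b w) (i : homset a w),
                       [/\ heart j, heart i & r = rho (j \oc f) i]].

Definition almost_amalgamation (R : realType) (K : normedCategory R) : Prop :=
  forall (a b c : K) (f : homset c a) (g : homset c b), heart f -> heart g ->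
  forall e : R, (0 < e)%R ->
  exists (w : K) (f' : homset a w) (g' : homset b w),
    [/\ heart f', heart g' & rho (f' \oc f) (g' \oc g) < e%:E].

(* Since [n <= m] is a boolean, its proofs are unique and [seq_map] does not
   depend on the choice of [le_nm]. *)
Record heartSequence (R : realType) (K : normedCategory R) := HeartSequence {
  seq_obj :> nat -> K;
  seq_map : forall n m, (n <= m)%N -> homset (seq_obj n) (seq_obj m);
  seq_map_heart : forall n m (le_nm : (n <= m)%N), heart (seq_map le_nm);
  seq_map_id : forall n, seq_map (leqnn n) = idm (seq_obj n);
  seq_map_comp : forall n m k (le_nm : (n <= m)%N) (le_mk : (m <= k)%N),
    seq_map (leq_trans le_nm le_mk) = seq_map le_mk \oc seq_map le_nm }.

(* "Increasing" is read as strictly increasing. *)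
Record approxArrow (R : realType) (K : normedCategory R)
    (x y : heartSequence K) := ApproxArrow {
  approx_index : nat -> nat;
  approx_index_lt : forall n m, (n < m)%N -> (approx_index n < approx_index m)%N;
  approx_arrow :> forall n, homset (x n) (y (approx_index n));
  approx_arrowP : forall e : R, (0 < e)%R ->
    exists n0, forall n m (lt_nm : (n < m)%N), (n0 <= n)%N ->
      rho (approx_arrow m \oc seq_map x (ltnW lt_nm))
          (seq_map y (ltnW (approx_index_lt lt_nm)) \oc approx_arrow n) < e%:E }.

(* The limit is a relation because [limn] takes the default value 0 on
   divergent sequences of extended reals. *)
Definition approx_mu_is (R : realType) (K : normedCategory R)
    (x y : heartSequence K) (f : approxArrow x y) (l : \bar R) : Prop :=
  mu (f n) @[n --> \oo] --> l.

Definition fraisse (R : realType) (K : normedCategory R)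
    (u : heartSequence K) : Prop :=
  (forall (x : K) (e : R), (0 < e)%R ->
     exists (n : nat) (f : homset x (u n)), mu f < e%:E) /\
  (forall (e : R), (0 < e)%R ->
   forall (n : nat) (y : K) (f : homset (u n) y), heart f ->
     exists (m : nat) (lt_nm : (n < m)%N) (g : homset y (u m)),
       mu g < e%:E /\ rho (seq_map u (ltnW lt_nm)) (g \oc f) < e%:E).

(* Main.v *)
Require Import Defs.
From HB Require Import structures.
From mathcomp Require Import all_boot all_order all_algebra.
From mathcomp Require Import all_classical all_reals all_analysis.
From mathcomp Require Import ring lra.

Set Implicit Arguments.
Unset Strict Implicit.
Unset Printing Implicit Defensive.

(** The approximate arrow is built one term at a time. An arrow
    [f : x n -> u p] with [mu f < e] has heart arrows [j], [i] out of [u p] and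
    [x n] with [j \oc f] within [e] of [i]. Almost amalgamating [i] with the
    bonding arrow [x n -> x n.+1] yields a heart arrow out of [u p] into an
    object that also receives a heart arrow from [x n.+1]; the absorption
    clause of [fraisse] sends that object back into [u] by some [g] with [mu g]
    as small as desired, almost inverting the heart arrow out of [u p].
    Composing gives the next term (lemma [fraisse_extend]). Its [mu] is small
    because precomposition with heart arrows does not increase [mu], and the
    square between the two terms commutes up to [e] plus an arbitrarily small
    error.

    The first term exists because every object almost embeds in [u]. When [mu]
    of the [n]-th term is kept below [2^-n], the [n]-th square commutes up to
    [2 * 2^-n]. Pasting squares adds their errors (lemma [square_telescope]),
    so the squares from index [n] on fail to commute by at most the tail
    [4 * 2^-n] of a geometric series, which tends to [0]. *)

Section NormedCategory.
Import Order.TTheory GRing.Theory Num.Theory.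
Import numFieldNormedType.Exports.
Local Open Scope classical_set_scope.
Local Open Scope ring_scope.
Local Open Scope ereal_scope.
Local Open Scope cat_scope.
Variables (R : realType) (K : normedCategory R).

Lemma mu_ge0 (a b : K) (f : homset a b) : 0 <= mu f.
Proof.
by apply: le_ereal_inf_tmp => _ [w [j [i [_ _ ->]]]]; apply: rho_ge0.
Qed.

Lemma mu_lt_witness (a b : K) (f : homset a b) (e : \bar R) : mu f < e ->
  exists (w : K) (j : homset b w) (i : homset a w),
    [/\ heart j, heart i & rho (j \oc f) i < e].
Proof.
move=> /ereal_inf_lt [_ [w [j [i [hj hi ->]]]] lt_e].
by exists w, j, i.
Qed.

(** Witnesses [j], [i] for [f] give witnesses [j], [i \oc k] for [f \oc k]. *)
Lemma mu_comp_heart (a b c : K) (f : homset b c) (k : homset a b) :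
  heart k -> mu (f \oc k) <= mu f.
Proof.
move=> hk; apply: le_ereal_inf_tmp => _ [w [j [i [hj hi ->]]]].
apply: le_trans (rho_comp_right _ _ k).
apply: ereal_inf_lbound; exists w, j, (i \oc k).
by split=> //; [exact: heart_comp | rewrite ccomp_assoc].
Qed.

(** The inductive step. The summand [e] comes from the failure of [f] to be a
    heart arrow, and the two summands [d] from amalgamating and from returning
    to [u] by absorption. *)
Lemma fraisse_extend (u : heartSequence K) (a b : K) (t : homset a b)
    (n : nat) (f : homset a (u n)) (e d : R) :
  almost_amalgamation K -> fraisse u -> heart t -> (0 < d)%R ->
  mu f < e%:E ->
  exists (m : nat) (lt_nm : (n < m)%N) (g : homset b (u m)),
    mu g < d%:E /\
    rho (g \oc t) (seq_map u (ltnW lt_nm) \oc f) < (e + d + d)%:E.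
Proof.
move=> amalg [_ absorb] ht d_gt0 /mu_lt_witness [w [j [i [hj hi jfi]]]].
have [v [i' [k [hi' hk i'ikt]]]] := amalg _ _ _ i t hi ht d d_gt0.
have [m [lt_nm [g [mug gi'j]]]] :=
  absorb d d_gt0 n v (i' \oc j) (heart_comp hi' hj).
exists m, lt_nm, (g \oc k); split.
  exact: le_lt_trans (mu_comp_heart _ hk) mug.
have kt_i : rho (g \oc k \oc t) (g \oc i' \oc i) < d%:E.
  rewrite -!ccomp_assoc; apply: le_lt_trans (rho_comp_left _ _ _) _.
  by rewrite rho_sym.
have i_jf : rho (g \oc i' \oc i) (g \oc i' \oc j \oc f) < e%:E.
  rewrite -(ccomp_assoc _ j f); apply: le_lt_trans (rho_comp_left _ _ _) _.
  by rewrite rho_sym.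
have jf_u : rho (g \oc i' \oc j \oc f) (seq_map u (ltnW lt_nm) \oc f) < d%:E.
  apply: le_lt_trans (rho_comp_right _ _ _) _.
  by rewrite rho_sym -ccomp_assoc.
apply: le_lt_trans (rho_triangle _ (g \oc i' \oc j \oc f) _) _.
rewrite EFinD; apply: lteD => //.
apply: le_lt_trans (rho_triangle _ (g \oc i' \oc i) _) _.
by rewrite addrC EFinD; apply: lteD.
Qed.

Lemma seq_map_split (x : heartSequence K) (n m k : nat) (le_nk : (n <= k)%N)
    (le_nm : (n <= m)%N) (le_mk : (m <= k)%N) :
  seq_map x le_nk = seq_map x le_mk \oc seq_map x le_nm.
Proof.
by rewrite -seq_map_comp; congr (seq_map _ _); exact: bool_irrelevance.
Qed.

Lemma seq_map_refl (x : heartSequence K) (n : nat) (le_nn : (n <= n)%N) :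
  seq_map x le_nn = idm (x n).
Proof. by rewrite (bool_irrelevance le_nn (leqnn n)) seq_map_id. Qed.

(** The square from [n] to [m.+1] is pasted from the one from [n] to [m] and
    the one from [m] to [m.+1]; neither composition increases an error.
    Writing the error as a difference [c n - c m] makes the sum telescope. *)
Lemma square_telescope (x y : heartSequence K) (phi : nat -> nat)
    (le_phi : forall n m, (n <= m)%N -> (phi n <= phi m)%N)
    (f : forall n, homset (x n) (y (phi n))) (c : nat -> R) :
  (forall n, rho (f n.+1 \oc seq_map x (leqnSn n))
                 (seq_map y (le_phi _ _ (leqnSn n)) \oc f n)
             <= (c n - c n.+1)%:E) ->
  forall n m (le_nm : (n <= m)%N),
    rho (f m \oc seq_map x le_nm) (seq_map y (le_phi _ _ le_nm) \oc f n)
    <= (c n - c m)%:E.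
Proof.
move=> step n; elim=> [|m IHm] le_nm.
  have n0 : n = 0%N by apply/eqP; rewrite -leqn0.
  subst n; rewrite !seq_map_refl ccomp_idl ccomp_idr subrr.
  by rewrite (proj2 (rho_eq0 _ _)).
have := le_nm; rewrite leq_eqVlt => /predU1P[eq_nm|le_nm'].
  subst n; rewrite !seq_map_refl ccomp_idl ccomp_idr subrr.
  by rewrite (proj2 (rho_eq0 _ _)).
have {}le_nm' : (n <= m)%N := le_nm'.
rewrite (seq_map_split x le_nm le_nm' (leqnSn m)).
rewrite (seq_map_split y (le_phi _ _ le_nm) (le_phi _ _ le_nm')
           (le_phi _ _ (leqnSn m))).
apply: le_trans (rho_triangle _
  (seq_map y (le_phi _ _ (leqnSn m)) \oc f m \oc seq_map x le_nm') _) _.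
have -> : (c n - c m.+1 = (c m - c m.+1) + (c n - c m))%R by ring.
rewrite EFinD; apply: leeD.
  by rewrite ccomp_assoc; apply: le_trans (rho_comp_right _ _ _) (step m).
by rewrite -!ccomp_assoc; apply: le_trans (rho_comp_left _ _ _) (IHm le_nm').
Qed.

(** A nonnegative [c] tending to [0] turns the telescoped bounds
    [c n - c m] into the condition on approximate arrows. *)
Lemma approx_arrow_of_steps (x y : heartSequence K) (phi : nat -> nat)
    (f : forall n, homset (x n) (y (phi n))) (c : nat -> R) :
  (forall n, 0 <= c n)%R -> c @ \oo --> (0 : R)%R ->
  (forall n, exists lt_phi : (phi n < phi n.+1)%N,
     rho (f n.+1 \oc seq_map x (leqnSn n))
         (seq_map y (ltnW lt_phi) \oc f n) <= (c n - c n.+1)%:E) ->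
  exists F : approxArrow x y, forall n, mu (F n) = mu (f n).
Proof.
move=> c_ge0 c_cvg sq.
have lt_phi : forall n m, (n < m)%N -> (phi n < phi m)%N.
  by apply: (homo_ltn ltn_trans) => n; case: (sq n).
have le_phi n m : (n <= m)%N -> (phi n <= phi m)%N.
  by rewrite leq_eqVlt => /predU1P[->//|/lt_phi/ltnW].
have bound : forall n m (le_nm : (n <= m)%N),
    rho (f m \oc seq_map x le_nm) (seq_map y (le_phi _ _ le_nm) \oc f n)
    <= (c n - c m)%:E.
  apply: square_telescope => n; case: (sq n) => lt_n.
  by rewrite (bool_irrelevance (ltnW lt_n) (le_phi _ _ (leqnSn n))).
have approxP (e : R) : (0 < e)%R ->
    exists n0, forall n m (lt_nm : (n < m)%N), (n0 <= n)%N ->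
      rho (f m \oc seq_map x (ltnW lt_nm))
          (seq_map y (ltnW (lt_phi _ _ lt_nm)) \oc f n) < e%:E.
  move=> e_gt0.
  have [n0 _ small] := (cvgr0Pnorm_lt _).1 c_cvg _ e_gt0.
  exists n0 => n m lt_nm le_n0n.
  rewrite (bool_irrelevance (ltnW (lt_phi _ _ lt_nm))
             (le_phi _ _ (ltnW lt_nm))).
  apply: le_lt_trans (bound _ _ (ltnW lt_nm)) _.
  rewrite lte_fin; apply: le_lt_trans (small n le_n0n).
  by rewrite ger0_norm ?c_ge0// gerBl c_ge0.
by exists (ApproxArrow approxP).
Qed.

(** Dependent choice iterates [fraisse_extend] with [e = 2^-n] and
    [d = 2^-(n+1)]. The step error [e + d + d] is then [2 * 2^-n], which is the
    decrement of the sequence [4 * 2^-n] between [n] and [n.+1]. *)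
Lemma fraisse_ladder (u x : heartSequence K) :
  almost_amalgamation K -> fraisse u ->
  exists (phi : nat -> nat) (f : forall n, homset (x n) (u (phi n))),
    (forall n, mu (f n) < (2^-1 ^+ n)%:E) /\
    (forall n, exists lt_phi : (phi n < phi n.+1)%N,
      rho (f n.+1 \oc seq_map x (leqnSn n))
          (seq_map u (ltnW lt_phi) \oc f n)
      <= (4 * 2^-1 ^+ n - 4 * 2^-1 ^+ n.+1)%:E).
Proof.
move=> amalg fr.
have e_gt0 n : (0 < 2^-1 ^+ n :> R)%R by rewrite exprn_gt0 // invr_gt0.
pose state n := {s : {p : nat & homset (x n) (u p)} |
                   mu (tagged s) < (2^-1 ^+ n)%:E}.
pose linked n (s : state n) (s' : state n.+1) :=
  exists lt_p : (tag (sval s) < tag (sval s'))%N,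
    rho (tagged (sval s') \oc seq_map x (leqnSn n))
        (seq_map u (ltnW lt_p) \oc tagged (sval s))
    <= (4 * 2^-1 ^+ n - 4 * 2^-1 ^+ n.+1)%:E.
have next n (s : state n) : {s' : state n.+1 | linked n s s'}.
  apply: cid; case: s => -[p f] /= mu_f.
  have [q [lt_pq [g [mu_g sq]]]] := fraisse_extend amalg fr
    (seq_map_heart x (leqnSn n)) (e_gt0 n.+1) mu_f.
  exists (exist _ (existT _ q g) mu_g), lt_pq => /=.
  apply: le_trans (ltW sq) _.
  by rewrite lee_fin exprS; lra.
have [p [f mu_f]] := fr.1 (x 0%N) _ (e_gt0 0%N).
pose s0 : state 0%N := exist _ (existT _ p f) mu_f.
pose s := nat_rect state s0 (fun n s => sval (next n s)).
exists (fun n => tag (sval (s n))), (fun n => tagged (sval (s n))); split.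
  by move=> n; apply: (svalP (s n)).
by move=> n; apply: (svalP (next n (s n))).
Qed.

Lemma half_expr_cvg0 : (fun n => 2^-1 ^+ n : R)%R @ \oo --> (0 : R)%R.
Proof. by apply: cvg_expr; rewrite ger0_norm ?invr_ge0// invf_lt1 ?ltr1n. Qed.

Lemma fraisse_approx_arrow (u x : heartSequence K) :
  almost_amalgamation K -> fraisse u ->
  exists f : approxArrow x u, approx_mu_is f 0.
Proof.
move=> amalg fr.
have [phi [f [mu_f sq]]] := fraisse_ladder x amalg fr.
have [||F muF] := approx_arrow_of_steps (c := fun n => 4 * 2^-1 ^+ n)%R _ _ sq.
- by move=> n; rewrite mulr_ge0// exprn_ge0// invr_ge0.
- by rewrite -[X in _ --> X](mulr0 4%R); apply: cvgMr; exact: half_expr_cvg0.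
exists F; rewrite /approx_mu_is.
apply: (@squeeze_cvge _ _ _ _ (fun=> 0) _ (fun n => (2^-1 ^+ n : R)%R%:E)).
- by apply: nearW => n; rewrite mu_ge0 muF ltW.
- exact: cvg_cst.
- by apply: cvg_EFin; [exact: nearW | exact: half_expr_cvg0].
Qed.

End NormedCategory.

Theorem theorem3p7 (R : realType) (K : normedCategory R)
    (hK : almost_amalgamation K) (u : heartSequence K) (hu : fraisse u)
    (x : heartSequence K) :
  exists f : approxArrow x u, approx_mu_is f 0%E.
Proof. exact: fraisse_approx_arrow. Qed.
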